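(* The bipartite construction $|G_{m,n}(t)\rangle=(Z^m\otimes Z^n)\,\mathrm{CP}(t)\,|+\rangle|+\rangle$ ($m,n=0,\ldots,D-1$, $t\in[0,1]$) of a family of equally entangled orthonormal bases generalizes to multipartite systems of arbitrary dimension, and works for any graph state of any dimension. Given a qudit graph state of several $D$-dimensional parties, replacing each controlled-phase gate $\mathrm{CP}$ in it by the gate $\mathrm{CP}(t)$ of tunable strength, and applying the local unitaries given by tensor products of powers of $Z$, yields a family of orthonormal bases, $t\in[0,1]$, that continuously interpolates between a product basis (at $t=0$) and the qudit graph basis (at $t=1$). For each fixed $t$ all basis states have the same entanglement, as quantified by any entanglement measure, since they differ only by local unitaries. In particular, the three-qubit GHZ state $(|000\rangle+|111\rangle)/\sqrt2$ is local-unitary equivalent to the graph state $\mathrm{CP}_{12}\mathrm{CP}_{23}\mathrm{CP}_{13}|+\rangle_1|+\rangle_2|+\rangle_3$ (with $D=2$), so varying the strength of the controlled-phase gates gives a family of equally entangled bases of the Hilbert space of 3 qubits that continuously interpolates between a product basis and the GHZ-like graph basis. This GHZ construction generalizes to higher dimensions $D$ and to $n$ parties by using the complete graph, i.e. the state $$|G_{\mathrm{GHZ}}(t)\rangle:=\prod_{i=1}^{n-1}\prod_{j>i}^{n}\mathrm{CP}_{ij}(t)\,|+\rangle^{\otimes n}.$$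
   Context: Each party has a $D$-dimensional complex Hilbert space with orthonormal basis $\{|k\rangle\}_{k=0}^{D-1}$. Notation: $\omega^{x}:=e^{2\pi i x/D}$ for real $x$; $|+\rangle=\frac{1}{\sqrt D}\sum_{k=0}^{D-1}|k\rangle$; $Z=\sum_{k=0}^{D-1}\omega^k|k\rangle\langle k|$; $\mathrm{CP}(t)=\sum_{j,k=0}^{D-1}\omega^{jkt}|j\rangle\langle j|\otimes|k\rangle\langle k|$, so that $\mathrm{CP}(0)$ is the identity and $\mathrm{CP}=\mathrm{CP}(1)$ is the generalized controlled-phase gate. The subscripts in $\mathrm{CP}_{ij}$ and $\mathrm{CP}_{ij}(t)$ indicate the pair of parties on which the gate acts (identity on the others). A qudit graph state is a state obtained from $|+\rangle^{\otimes n}$ by applying gates $\mathrm{CP}_{ij}$ to the pairs of parties joined by edges of a graph whose vertices are the $n$ parties. The corresponding graph basis consists of the $D^n$ states obtained from the graph state by applying $Z^{m_1}\otimes\cdots\otimes Z^{m_n}$ with $m_1,\ldots,m_n\in\{0,\ldots,D-1\}$. A product basis is a basis in which every state is a product state. A local unitary is one of the form $U_1\otimes\cdots\otimes U_n$. *)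

(* Defs.v *)
From HB Require Import structures.
From mathcomp Require Import all_boot all_order all_algebra.
From mathcomp Require Import all_classical all_reals all_analysis.
From mathcomp Require Import complex.

Set Implicit Arguments.
Unset Strict Implicit.
Unset Printing Implicit Defensive.

Import Order.TTheory GRing.Theory Num.Theory.
Import numFieldNormedType.Exports.

Local Open Scope classical_set_scope.
Local Open Scope ring_scope.
Local Open Scope sesquilinear_scope.
Local Open Scope complex_scope.

(* The Hilbert space of n parties of dimension D has the computational basis
   |x_0 ... x_(n-1)> labelled by x : config D n.  Vectors and operators are
   column vectors and square matrices of size #|config D n| (that is, D ^ n),
   the coordinate of index a being the one of label (label a). *)
Notation config D n := {ffun 'I_n -> 'I_D}.
Notation dimH D n := #|{: config D n}|.
Notation state R D n := 'cV[R[i]]_(dimH D n).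
Notation operator R D n := 'M[R[i]]_(dimH D n).

Definition label (D n : nat) (a : 'I_(dimH D n)) : config D n := enum_val a.

Definition tens_vec (R : realType) (D n : nat) (phi : 'I_n -> 'cV[R[i]]_D) :
    state R D n :=
  \col_a \prod_(i < n) phi i (label a i) 0.

Definition tens_op (R : realType) (D n : nat) (A : 'I_n -> 'M[R[i]]_D) :
    operator R D n :=
  \matrix_(a, b) \prod_(i < n) A i (label a i) (label b i).

(* |k>, |+> and the clock operator of a single party *)
Definition ket (R : realType) (D : nat) (k : 'I_D) : 'cV[R[i]]_D :=
  delta_mx k 0.

Definition omega (R : realType) (D : nat) (x : R) : R[i] :=
  cos (2 * pi * x / D%:R) +i* sin (2 * pi * x / D%:R).

Definition plus (R : realType) (D : nat) : 'cV[R[i]]_D :=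
  (sqrtC D%:R)^-1 *: \sum_(k < D) ket R k.

Definition Zop (R : realType) (D : nat) : 'M[R[i]]_D :=
  \sum_(k < D) omega D k%:R *: delta_mx k k.

Definition plus_state (R : realType) (D n : nat) : state R D n :=
  tens_vec (fun _ => plus R D).

(* Z^(m_0) (x) ... (x) Z^(m_(n-1)) *)
Definition Zpow (R : realType) (D n : nat) (m : config D n) : operator R D n :=
  tens_op (fun i => Zop R D ^+ m i).

(* CP_ij(t) for i != j; in this sum the exponent of omega is k * l * t, and
   |k><k| sits on party i, |l><l| on party j, the identity elsewhere *)
Definition CPt (R : realType) (D n : nat) (t : R) (i j : 'I_n) :
    operator R D n :=
  \sum_(k < D) \sum_(l < D) omega D ((k * l)%:R * t) *:
    tens_op (fun p => if p == i then delta_mx k k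
                      else if p == j then delta_mx l l else 1%:M).

Definition CP (R : realType) (D n : nat) : 'I_n -> 'I_n -> operator R D n :=
  CPt D (1 : R).

(* A graph on the parties is an irreflexive symmetric relation e; each edge is
   an unordered pair, hence occurs once in this product. *)
Definition circuit (R : realType) (D n : nat)
    (gate : 'I_n -> 'I_n -> operator R D n) (e : rel 'I_n) : operator R D n :=
  \prod_(i < n) \prod_(j < n | (i < j)%N && e i j) gate i j.

Definition graph_state (R : realType) (D n : nat) (e : rel 'I_n) :
    state R D n :=
  circuit (@CP R D n) e *m plus_state R D n.

Definition graph_basis (R : realType) (D n : nat) (e : rel 'I_n)
    (m : config D n) : state R D n :=
  Zpow R m *m graph_state R D e.

Definition tuned_graph_state (R : realType) (D n : nat) (e : rel 'I_n)
    (t : R) : state R D n :=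
  circuit (CPt D t) e *m plus_state R D n.

Definition tuned_graph_basis (R : realType) (D n : nat) (e : rel 'I_n)
    (t : R) (m : config D n) : state R D n :=
  Zpow R m *m tuned_graph_state D e t.

Definition complete_graph (n : nat) : rel 'I_n := fun i j => i != j.

Definition bipartite_family (R : realType) (D : nat) (t : R)
    (m : config D 2) : state R D 2 :=
  Zpow R m *m (CPt D t ord0 ord_max *m plus_state R D 2).

Definition ghz_tuned (R : realType) (D n : nat) (t : R) : state R D n :=
  (\prod_(i < n) \prod_(j < n | (i < j)%N) CPt D t i j) *m plus_state R D n.

Definition ghz (R : realType) (D n : nat) : state R D n :=
  (sqrtC D%:R)^-1 *: \sum_(k < D) tens_vec (fun _ : 'I_n => ket R k).

Definition braket (R : realType) (N : nat) (u v : 'cV[R[i]]_N) : R[i] :=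
  (u ^t* *m v) 0 0.

Definition projector (R : realType) (N : nat) (v : 'cV[R[i]]_N) : 'M[R[i]]_N :=
  v *m v ^t*.

Definition orthonormal_basis (R : realType) (D n : nat)
    (B : config D n -> state R D n) : Prop :=
  (forall m m', braket (B m) (B m') = (m == m')%:R) /\
  basis_of fullv (codom B).

Definition is_product (R : realType) (D n : nat) (v : state R D n) : Prop :=
  exists phi : 'I_n -> 'cV[R[i]]_D, v = tens_vec phi.

Definition product_basis (R : realType) (D n : nat)
    (B : config D n -> state R D n) : Prop :=
  orthonormal_basis B /\ forall m, is_product (B m).

Definition LU_equivalent (R : realType) (D n : nat) (u v : state R D n) :
    Prop :=
  exists U : 'I_n -> 'M[R[i]]_D,
    (forall i, U i \is unitarymx) /\ v = tens_op U *m u.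

Definition density (R : realType) (N : nat) (rho : 'M[R[i]]_N) : Prop :=
  (forall v : 'cV[R[i]]_N, 0 <= braket v (rho *m v)) /\ \tr rho = 1.

Definition separable (R : realType) (D n : nat) (rho : operator R D n) : Prop :=
  exists (r : nat) (p : 'I_r -> R[i]) (phi : 'I_r -> 'I_n -> 'cV[R[i]]_D),
    (forall k, 0 <= p k) /\
    rho = \sum_(k < r) p k *: projector (tens_vec (phi k)).

Definition local_op (R : realType) (D n : nat) (i : 'I_n) (A : 'M[R[i]]_D) :
    operator R D n :=
  tens_op (fun p => if p == i then A else 1%:M).

(* Kraus operators of the finite-round protocols of local operations and
   classical communication: some party i performs a generalized measurement
   (A k)_k and announces the outcome k, on which the rest of the protocol
   depends. *)
Inductive locc (R : realType) (D n : nat) : seq (operator R D n) -> Prop :=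
| locc_stop : locc [:: 1%:M]
| locc_round (i : 'I_n) (r : nat) (A : 'I_r -> 'M[R[i]]_D)
    (K : 'I_r -> seq (operator R D n)) :
    \sum_(k < r) (A k) ^t* *m A k = 1%:M ->
    (forall k, locc (K k)) ->
    locc (flatten [seq [seq B *m local_op i (A k) | B <- K k]
                  | k <- enum 'I_r]).

Definition kraus_map (R : realType) (N : nat) (K : seq 'M[R[i]]_N)
    (rho : 'M[R[i]]_N) : 'M[R[i]]_N :=
  \sum_(B <- K) B *m rho *m B ^t*.

Definition entanglement_measure (R : realType) (D n : nat)
    (E : operator R D n -> \bar R) : Prop :=
  [/\ forall rho, density rho -> (0 <= E rho)%E,
      forall rho, density rho -> separable rho -> E rho = 0%E
    & forall rho K, density rho -> locc K -> (E (kraus_map K rho) <= E rho)%E].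

Definition equally_entangled (R : realType) (D n : nat)
    (B : config D n -> state R D n) : Prop :=
  forall E : operator R D n -> \bar R, entanglement_measure E ->
  forall m m', E (projector (B m)) = E (projector (B m')).

(* R[i] seen as an abstract numeric field, whose norm topology the library
   provides; matrices over it carry the product topology. *)
Definition complexes (R : realType) : numClosedFieldType := R[i].

(* G t is a family of equally entangled orthonormal bases, t in [0, 1], that
   interpolates continuously between a product basis and the basis B; for each
   t the states of G t differ only by local unitaries. *)
Definition equally_entangled_interpolation (R : realType) (D n : nat)
    (G : R -> config D n -> state R D n) (B : config D n -> state R D n) :
    Prop :=
  [/\ forall t : R, 0 <= t <= 1 -> orthonormal_basis (G t),
      forall m, {within `[0, 1], continuous
        (fun t : R => G t m : 'cV[complexes R]_(dimH D n))},
      product_basis (G 0) /\ G 1 =1 B,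
      forall t : R, 0 <= t <= 1 -> forall m m', LU_equivalent (G t m) (G t m')
    & forall t : R, 0 <= t <= 1 -> equally_entangled (G t)].

(* Main.v *)
Require Import Defs.
From HB Require Import structures.
From mathcomp Require Import all_boot all_order all_algebra.
From mathcomp Require Import all_classical all_reals all_analysis.
From mathcomp Require Import complex ring lra.

(* All operators involved are diagonal in the computational basis, so
   Zpow m *m tuned_graph_state D e t has the amplitude
   D^(-n/2) omega^(m.x + t Q(x)) at |x>, where Q(x) is the sum of x_i x_j over
   the edges.  The phase t Q cancels in inner products, which gives
   orthonormality; changing m is a local diagonal unitary, hence an invertible
   LOCC protocol with a single Kraus operator, so that every entanglement
   measure takes the same value.

   For the complete graph, Q(x) = f(x_1 + ... + x_n) - f(x_1) - ... - f(x_n)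
   with f(y) = y (y + D) / 2.  The function omega^f is periodic modulo D and its
   discrete Fourier coefficients all have the same modulus (a Gauss sum), so up
   to local unitaries the state is the sum over k of the tensor powers of the
   Fourier basis vectors, that is, the GHZ state. *)

Set Implicit Arguments.
Unset Strict Implicit.
Unset Printing Implicit Defensive.

Import Order.TTheory GRing.Theory Num.Theory.
Import numFieldNormedType.Exports.

Local Open Scope ring_scope.
Local Open Scope sesquilinear_scope.
Local Open Scope complex_scope.

(** * Roots of unity *)

Section Omega.
Context {R : realType} (D : nat).
Implicit Types x y : R.

Lemma omega0 : omega D (0 : R) = 1.
Proof. by rewrite /omega mulr0 mul0r cos0 sin0. Qed.

Lemma omegaD x y : omega D (x + y) = omega D x * omega D y.
Proof.
rewrite /omega mulrDr mulrDl cosD sinD; apply/eqP; rewrite eq_complex /=.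
by rewrite eqxx addrC eqxx.
Qed.

Lemma conj_omega x : Num.conj (omega D x) = omega D (- x).
Proof. by rewrite /omega mulrN mulNr cosN sinN. Qed.

Lemma omegaNr x : omega D (- x) * omega D x = 1.
Proof. by rewrite -omegaD addNr omega0. Qed.

Lemma omega_sum (I : Type) (r : seq I) (P : pred I) (F : I -> R) :
  omega D (\sum_(i <- r | P i) F i) = \prod_(i <- r | P i) omega D (F i).
Proof. exact: (big_morph _ omegaD omega0). Qed.

Lemma omegaMn x k : omega D (x *+ k) = omega D x ^+ k.
Proof. by elim: k => [|k IH]; rewrite ?omega0// mulrS omegaD IH exprS. Qed.

Hypothesis D_gt0 : (0 < D)%N.

Lemma omega_period : omega D (D%:R : R) = 1.
Proof.
by rewrite /omega mulfK ?pnatr_eq0 -?lt0n// mulr_natl cos2pi sin2pi.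
Qed.

Lemma omega_nat_period k : omega D ((k * D)%:R : R) = 1.
Proof. by rewrite natrM mulr_natl omegaMn omega_period expr1n. Qed.

(** With x = pi d / D strictly between 0 and pi, the real part is cos 2x = 1 - 2 sin^2 x < 1. *)
Lemma omega_neq1 d : (0 < d < D)%N -> omega D (d%:R : R) != 1.
Proof.
move=> /andP[d0 dD]; rewrite /omega eq_complex /= negb_and.
have D0 : 0 < (D%:R : R) by rewrite ltr0n.
set x : R := pi * d%:R / D%:R.
have -> : 2 * pi * d%:R / D%:R = x + x by rewrite /x -!mulrA -mulr2n mulr_natl.
have x_gt0 : 0 < sin x.
  apply: sin_gt0_pi; rewrite /x divr_gt0 ?mulr_gt0 ?pi_gt0 ?ltr0n//=.
  by rewrite ltr_pdivrMr// ltr_pM2l ?pi_gt0 // ltr_nat.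
rewrite cosD -!expr2 cos2sin2 -addrA -opprD -mulr2n.
by rewrite -subr_eq0 addrAC subrr add0r oppr_eq0 mulrn_eq0 /= sqrf_eq0 gt_eqF.
Qed.

Lemma sum_omega_nat d :
  (0 < d < D)%N -> \sum_(k < D) omega D (d%:R *+ k : R) = 0.
Proof.
move=> dD; have := subrX1 (omega D (d%:R : R)) D.
rewrite -omegaMn -mulrnA omega_nat_period subrr => /esym/eqP.
rewrite mulf_eq0 subr_eq0.
rewrite (negPf (omega_neq1 dD)) /= => /eqP; under eq_bigr do rewrite -omegaMn.
by [].
Qed.

Lemma sum_omega (j l : 'I_D) :
  \sum_(k < D) omega D ((l%:R - j%:R) * k%:R : R) = D%:R * (j == l)%:R.
Proof.
have [->|jl] := eqVneq j l.
  rewrite (eq_bigr (fun=> 1)) => [|k _]; last by rewrite subrr mul0r omega0.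
  by rewrite sumr_const card_ord mulr1.
rewrite mulr0; case: (ltnP j l) => [lt_jl|].
  rewrite -[RHS](@sum_omega_nat (l - j)).
    by apply: eq_bigr => k _; rewrite mulr_natr natrB // ltnW.
  by rewrite subn_gt0 lt_jl (leq_ltn_trans (leq_subr _ _)).
rewrite leq_eqVlt eq_sym (inj_eq val_inj) (negPf jl) /= => lt_lj.
(* Conjugation negates the exponent and fixes 0, which reduces to the positive difference
   [j - l]. *)
apply: (can_inj conjCK); rewrite rmorph_sum rmorph0.
rewrite -[RHS](@sum_omega_nat (j - l)).
  apply: eq_bigr => k _; rewrite /= conj_omega -mulNr opprB mulr_natr natrB //.
  exact: ltnW.
by rewrite subn_gt0 lt_lj (leq_ltn_trans (leq_subr _ _)).
Qed.

End Omega.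

(** * Tensor products and local operations *)

Section TensorProducts.
Context {R : realType} {D n : nat}.
Implicit Types (A B U : 'I_n -> 'M[R[i]]_D) (phi : 'I_n -> 'cV[R[i]]_D).

Lemma label_inj : injective (@label D n).
Proof. exact: enum_val_inj. Qed.

Lemma sum_label (V : nmodType) (F : config D n -> V) :
  \sum_a F (label a) = \sum_x F x.
Proof. by rewrite (reindex (@label D n)) //; exact/onW_bij/enum_val_bij. Qed.

Lemma eq_tens_op A B : A =1 B -> tens_op A = tens_op B.
Proof.
by move=> AB; apply/matrixP => a b; rewrite !mxE; under eq_bigr do rewrite AB.
Qed.

(** By distributivity, a product over parties of sums over one index is a sum over labels of
    products. *)
Lemma tens_op_mul A B : tens_op A *m tens_op B = tens_op (fun i => A i *m B i).
Proof.
apply/matrixP => a b; rewrite !mxE.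
under [RHS]eq_bigr do rewrite mxE.
rewrite bigA_distr_bigA /= -sum_label.
by apply: eq_bigr => c _; rewrite !mxE -big_split.
Qed.

Lemma tens_op_vec A phi :
  tens_op A *m tens_vec phi = tens_vec (fun i => A i *m phi i).
Proof.
apply/matrixP => a b; rewrite !mxE.
under [RHS]eq_bigr do rewrite mxE.
rewrite bigA_distr_bigA /= -sum_label.
by apply: eq_bigr => c _; rewrite !mxE -big_split.
Qed.

Lemma prod_delta (x y : config D n) :
  \prod_(i < n) (x i == y i)%:R = (x == y)%:R :> R[i].
Proof.
have [->|xy] := eqVneq x y; first by rewrite big1 // => i _; rewrite eqxx.
have /existsP[i xyi] : [exists i, x i != y i].
  apply: contraR xy; rewrite negb_exists => /forallP xy.
  by apply/eqP/ffunP => i; apply/eqP; have := xy i; rewrite negbK.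
by rewrite (bigD1 i) //= (negPf xyi) mul0r.
Qed.

Lemma tens_op1 : tens_op (fun _ : 'I_n => 1%:M : 'M[R[i]]_D) = 1%:M.
Proof.
apply/matrixP => a b; rewrite !mxE -(inj_eq label_inj).
by under eq_bigr do rewrite mxE; rewrite prod_delta.
Qed.

End TensorProducts.

(** [unitarymx] gives U U^t* = 1, while the completeness relation of an LOCC round asks for U^t* U =
    1; for square matrices these agree. *)
Lemma unitary_isometry (C : numClosedFieldType) N (U : 'M[C]_N) :
  U \is unitarymx -> U^t* *m U = 1%:M.
Proof. by move/unitarymxP/mulmx1C. Qed.

Section LocalOperations.
Context {R : realType} {D n : nat}.
Implicit Types (U : 'I_n -> 'M[R[i]]_D).

(** The parties apply their unitaries in turn, each as a generalized measurement with a single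
    outcome; the induction is on the number [k] of parties involved. *)
Lemma locc_tens_op U : (forall i, U i \is unitarymx) -> locc [:: tens_op U].
Proof.
move=> Uu.
suff partial k :
    locc [:: tens_op (fun i : 'I_n => if (i < k)%N then U i else 1%:M)].
  have := partial n; congr (locc [:: _]); apply: eq_tens_op => i.
  by rewrite ltn_ord.
elim: k => [|k IH].
  by rewrite [tens_op _]tens_op1; exact: locc_stop.
have [kn|nk] := ltnP k n; last first.
  move: IH; congr (locc [:: _]); apply: eq_tens_op => i.
  by rewrite !(leq_trans (ltn_ord i)) // (leq_trans nk).
(* Party [k] acts first; the protocol of the lower-numbered parties follows, so their operator
   stands on the left. *)
have := @locc_round R D n (Ordinal kn) 1 (fun=> U (Ordinal kn)) (fun=> [:: _]).
move=> /(_ _ _ (fun=> IH)); rewrite big_ord1 => /(_ (unitary_isometry (Uu _))).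
rewrite enum_ordSl enum_ord0 /= /local_op tens_op_mul.
congr (locc [:: _]); apply: eq_tens_op => i.
rewrite ltnS [(i <= k)%N]leq_eqVlt -(inj_eq val_inj) /=.
have [ik|_] := eqVneq (i : nat) k; last by rewrite mulmx1.
by rewrite ik ltnn mul1mx (_ : i = Ordinal kn) //; exact: val_inj.
Qed.

Lemma density_projector N (v : 'cV[R[i]]_N) :
  braket v v = 1 -> density (projector v).
Proof.
move=> v1; split=> [w|].
  (* <w|v><v|w> is the squared modulus of <v|w>. *)
  rewrite /braket /projector -(mulmxA v) (mulmxA _ v) mxE big_ord1 mulrC.
  have -> : (w^t* *m v) 0 0 = Num.conj ((v^t* *m w) 0 0).
    rewrite !mxE rmorph_sum; apply: eq_bigr => k _.
    by rewrite !mxE rmorphM mulrC /= conjCK.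
  exact: mul_conjC_ge0.
by rewrite /projector mxtrace_mulC trace_mx11.
Qed.

Lemma kraus_projector N (U : 'M[R[i]]_N) (v : 'cV[R[i]]_N) :
  kraus_map [:: U] (projector v) = projector (U *m v).
Proof. by rewrite /kraus_map big_seq1 /projector trmx_mul map_mxM !mulmxA. Qed.

(** A local unitary is a one-operator LOCC protocol, so monotonicity gives this inequality; equality
    comes from applying it in both directions. *)
Lemma LU_equivalent_le (E : operator R D n -> \bar R) (u v : state R D n) :
  entanglement_measure E -> braket u u = 1 -> LU_equivalent u v ->
  (E (projector v) <= E (projector u))%E.
Proof.
case=> _ _ mono u1 [U [Uu ->]]; rewrite -kraus_projector.
by apply: mono; [exact: density_projector | exact: locc_tens_op].
Qed.

End LocalOperations.

(** * Phase states *)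

Section PhaseStates.
Context {R : realType} {D n : nat}.
Implicit Types (f g : config D n -> R) (t : R) (m x : config D n).
Implicit Types (e : rel 'I_n).

(** Exponents are kept as real functions on labels, so that products of diagonal operators become
    sums of exponents. *)
Definition phase_op f : operator R D n :=
  diag_mx (\row_a omega D (f (label a))).

Definition phase_state f : state R D n :=
  \col_a ((sqrtC D%:R)^-1 ^+ n * omega D (f (label a))).

Definition local_phase (h : 'I_D -> R) : 'M[R[i]]_D :=
  diag_mx (\row_k omega D (h k)).

(** The quadratic form Q of the graph; the condition i < j counts each edge once, as in
    [circuit]. *)
Definition pair_sum (e : rel 'I_n) x : nat :=
  \sum_(i < n) \sum_(j < n | (i < j)%N && e i j) x i * x j.

Lemma eq_phase_op f g : f =1 g -> phase_op f = phase_op g.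
Proof. by move=> fg; congr diag_mx; apply/rowP => a; rewrite !mxE fg. Qed.

Lemma eq_phase_state f g : f =1 g -> phase_state f = phase_state g.
Proof. by move=> fg; apply/colP => a; rewrite !mxE fg. Qed.

Lemma phase_op0 : phase_op (fun=> 0) = 1%:M.
Proof. by apply/matrixP => a b; rewrite !mxE omega0. Qed.

Lemma phase_op_mul f g :
  phase_op f *m phase_op g = phase_op (fun x => f x + g x).
Proof.
rewrite /phase_op mulmx_diag; congr diag_mx; apply/rowP => a.
by rewrite !mxE omegaD.
Qed.

Lemma phase_op_prod (I : Type) (r : seq I) (P : pred I)
    (F : I -> config D n -> R) :
  \prod_(i <- r | P i) phase_op (F i) =
  phase_op (fun x => \sum_(i <- r | P i) F i x).
Proof.
elim: r => [|i r IH].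
  by rewrite big_nil -[LHS]phase_op0; apply: eq_phase_op => x; rewrite big_nil.
rewrite big_cons IH; case Pi: (P i).
  rewrite -[_ * _]/(_ *m _) phase_op_mul; apply: eq_phase_op => x.
  by rewrite big_cons Pi.
by apply: eq_phase_op => x; rewrite big_cons Pi.
Qed.

Lemma phase_op_state f g :
  phase_op f *m phase_state g = phase_state (fun x => f x + g x).
Proof.
by apply/colP => a; rewrite mul_diag_mx !mxE omegaD mulrCA.
Qed.

Lemma local_phase_unitary h : local_phase h \is unitarymx.
Proof.
apply/unitarymxP/matrixP => j k.
rewrite mul_diag_mx !mxE eq_sym; case: eqP => [->|_] /=.
  by rewrite !mulr1n conj_omega mulrC omegaNr.
by rewrite !mulr0n rmorph0 mulr0.
Qed.

Lemma tens_op_local_phase (h : 'I_n -> 'I_D -> R) :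
  tens_op (fun i => local_phase (h i)) =
  phase_op (fun x => \sum_i h i (x i)).
Proof.
apply/matrixP => a b; rewrite !mxE.
under eq_bigr do rewrite mxE mxE -mulr_natr.
rewrite big_split /= prod_delta (inj_eq label_inj) mulr_natr.
by rewrite omega_sum.
Qed.

Lemma Zop_local_phase : Zop R D = local_phase (fun k => k%:R).
Proof.
apply/matrixP => j k; rewrite /Zop summxE !mxE.
rewrite (bigD1 j) //= big1 => [|l lj]; rewrite !mxE.
  by rewrite addr0 eqxx /= eq_sym mulr_natr.
by rewrite eq_sym (negPf lj) mulr0.
Qed.

Lemma Zop_exp k : Zop R D ^+ k = local_phase (fun l => (k * l)%:R).
Proof.
rewrite Zop_local_phase; elim: k => [|k IH].
  by apply/matrixP => i j; rewrite expr0 !mxE mul0n omega0.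
rewrite exprS IH -[_ * _]/(_ *m _) /local_phase mulmx_diag.
by congr diag_mx; apply/rowP => i; rewrite !mxE -omegaD -natrD mulSn.
Qed.

Lemma Zpow_phase_op m : Zpow R m = phase_op (fun x => (\sum_i m i * x i)%:R).
Proof.
rewrite /Zpow (eq_tens_op (fun i => Zop_exp (m i))) tens_op_local_phase.
by apply: eq_phase_op => x; rewrite natr_sum.
Qed.

Lemma CPt_phase_op t i j :
  i != j -> CPt D t i j = phase_op (fun x => (x i * x j)%:R * t).
Proof.
move=> ij; apply/matrixP => a b; rewrite /CPt summxE !mxE.
(* In row [a] only the projectors with [k] and [l] equal to the labels at [i] and [j] survive, so
   the double sum has one term. Distinctness of [i] and [j] ensures that the factor at [j] is
   |l><l|. *)
have entry (k l : 'I_D) : (omega D ((k * l)%:R * t) *: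
    tens_op (fun p => if p == i then delta_mx k k
                      else if p == j then delta_mx l l else 1%:M)) a b =
    if (label a i == k) && (label a j == l) then
      omega D ((k * l)%:R * t) *+ (a == b) else 0.
  rewrite !mxE; case: ifP => [/andP[/eqP <- /eqP <-]|/negbT].
    rewrite -[RHS]mulr_natr; congr (_ * _).
    rewrite -(inj_eq label_inj) -prod_delta; apply: eq_bigr => p _.
    case: eqP => [->|_]; first by rewrite !mxE eqxx eq_sym.
    by case: eqP => [->|_]; rewrite !mxE ?eqxx // eq_sym.
  rewrite negb_and => /orP[ak|al].
    by rewrite (bigD1 i) //= eqxx mxE (negPf ak) mul0r mulr0.
  by rewrite (bigD1 j) //= eq_sym (negPf ij) eqxx mxE (negPf al) mul0r mulr0.
rewrite (bigD1 (label a i)) //= [X in _ + X]big1 => [|k ki]; last first.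
  rewrite summxE big1 // => l _; rewrite entry.
  by rewrite eq_sym (negPf ki).
rewrite summxE (bigD1 (label a j)) //= big1 => [|l lj]; last first.
  by rewrite entry [label a j == l]eq_sym (negPf lj) andbF.
by rewrite entry !eqxx !addr0.
Qed.

Lemma circuit_phase_op t e :
  circuit (CPt D t) e = phase_op (fun x => (pair_sum e x)%:R * t).
Proof.
rewrite /circuit; under eq_bigr => i _.
  rewrite (eq_bigr (fun j => phase_op (fun x => (x i * x j)%:R * t))).
    rewrite phase_op_prod; over.
  by move=> j /andP[ij _]; rewrite CPt_phase_op // neq_ltn ij.
rewrite phase_op_prod; apply: eq_phase_op => x.
rewrite /pair_sum natr_sum mulr_suml; apply: eq_bigr => i _.
by rewrite natr_sum mulr_suml.
Qed.

Lemma plusE k : plus R D k 0 = (sqrtC D%:R)^-1.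
Proof.
rewrite /plus mxE summxE (bigD1 k) //= big1 => [|l lk]; rewrite !mxE.
  by rewrite !eqxx addr0 mulr1.
by rewrite eq_sym (negPf lk).
Qed.

Lemma plus_phase_state : plus_state R D n = phase_state (fun=> 0).
Proof.
apply/colP => a; rewrite !mxE omega0 mulr1.
by under eq_bigr do rewrite plusE; rewrite prodr_const card_ord.
Qed.

Lemma tuned_graph_phase_state e t :
  tuned_graph_state D e t = phase_state (fun x => (pair_sum e x)%:R * t).
Proof.
rewrite /tuned_graph_state circuit_phase_op plus_phase_state phase_op_state.
by apply: eq_phase_state => x; rewrite addr0.
Qed.

End PhaseStates.

Lemma conj_invsqrt_nat (C : numClosedFieldType) k :
  Num.conj (sqrtC k%:R)^-1 = (sqrtC k%:R)^-1 :> C.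
Proof.
by apply/CrealP; rewrite realV ger0_real // sqrtC_ge0 ler0n.
Qed.

Lemma sqr_invsqrt_nat (C : numClosedFieldType) k :
  (sqrtC k%:R)^-1 * (sqrtC k%:R)^-1 = k%:R^-1 :> C.
Proof. by rewrite -expr2 exprVn sqrtCK. Qed.

(** * Orthonormality of phase states *)

Section Orthonormality.
Context {R : realType} {D n : nat}.

(** There are as many vectors as the dimension, so freeness suffices: pairing a vanishing
    combination with [B (label i)] leaves only its coefficient [c i]. *)
Lemma orthonormal_is_basis (B : config D n -> state R D n) :
  (forall m m', braket (B m) (B m') = (m == m')%:R) -> orthonormal_basis B.
Proof.
move=> oB; split=> //; rewrite basisEfree subvf dimvf /= size_map -cardE.
rewrite /dim /= muln1 leqnn !andbT.
have sz : size (codom B) == dimH D n by rewrite size_codom.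
apply/(@freeP _ _ _ (Tuple sz)) => c c0 i.
have eqB (j : 'I_(dimH D n)) : (Tuple sz)`_j = B (label j).
  rewrite /= /codom /image_mem (nth_map (label j)) -?cardE //.
  by congr B; rewrite -enum_val_nth.
have := congr1 (braket (B (label i))) c0.
rewrite /braket mulmx_sumr summxE mulmx0 mxE => <-.
rewrite (bigD1 i) //= big1 => [|j ji].
  by rewrite -scalemxAr mxE eqB -/(braket _ _) oB eqxx mulr1 addr0.
rewrite -scalemxAr mxE eqB -/(braket _ _) oB (inj_eq label_inj).
by rewrite eq_sym (negPf ji) mulr0.
Qed.

(** The common phase [q] cancels, and the remaining sum over labels factors into one character sum
    per party, which vanishes unless [m i = m' i]. *)
Lemma braket_phase_state (m m' : config D n) (q : config D n -> R) :
  (0 < D)%N ->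
  braket (phase_state (fun x => (\sum_i m i * x i)%:R + q x))
         (phase_state (fun x => (\sum_i m' i * x i)%:R + q x)) = (m == m')%:R.
Proof.
move=> D0; rewrite /braket mxE.
transitivity (D%:R ^- n * \sum_(x : config D n) \prod_(i < n)
    omega D (((m' i)%:R - (m i)%:R) * (x i)%:R : R)).
  rewrite -sum_label mulr_sumr; apply: eq_bigr => a _.
  rewrite !mxE rmorphM rmorphXn /= conj_invsqrt_nat conj_omega mulrACA.
  rewrite -exprMn sqr_invsqrt_nat exprVn -omegaD -omega_sum.
  congr (_ * omega _ _).
  under [RHS]eq_bigr do rewrite mulrBl -!natrM.
  rewrite sumrB !natr_sum opprD addrCA addrA addrAC; lra.
rewrite -(bigA_distr_bigA (fun i (k : 'I_D) =>
  omega D (((m' i)%:R - (m i)%:R) * k%:R : R))) /=.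
under eq_bigr do rewrite sum_omega //.
rewrite big_split /= prodr_const card_ord mulrA mulVf ?mul1r ?prod_delta //.
by rewrite expf_neq0 // pnatr_eq0 -lt0n.
Qed.

End Orthonormality.

(** * Continuity in the tuning parameter *)

Section Continuity.
Context {R : realType}.

(** The norm of [complexes R] takes values in the field itself, so a positive radius is first
    recognised as a real r. Bounds of r/2 on both parts then give a squared modulus below r^2/2 <
    r^2. *)
Lemma continuous_complex (u v : R -> R) : continuous u -> continuous v ->
  continuous (fun t => u t +i* v t : complexes R).
Proof.
move=> cu cv t; apply/cvgrPdist_lt => eps eps0.
have [r r0 ->] : exists2 r : R, 0 < r & eps = r%:C.
  move: eps0; case: eps => r s; rewrite ltcE /= => /andP[/eqP -> r0].
  by exists r.
have r2 : 0 < r / 2 by rewrite divr_gt0.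
have /cvgrPdist_lt/(_ _ r2) nu := cu t.
have /cvgrPdist_lt/(_ _ r2) nv := cv t.
near=> s.
have us : `|u t - u s| < r / 2 by near: s.
have vs : `|v t - v s| < r / 2 by near: s.
rewrite normc_def ltcR /=.
rewrite -(ltr_pXn2r (ltn0Sn 1)) ?nnegrE ?sqrtr_ge0 ?(ltW r0) //.
rewrite sqr_sqrtr ?addr_ge0 ?sqr_ge0 //.
rewrite -(real_normK (num_real (u t - u s))).
rewrite -(real_normK (num_real (v t - v s))).
have := normr_ge0 (u t - u s); have := normr_ge0 (v t - v s); nra.
Unshelve. all: by end_near. Qed.

(** A neighbourhood in the matrix topology contains a box of entrywise neighbourhoods, and there are
    finitely many entries. *)
Lemma continuous_mx (S T : topologicalType) p q (F : S -> 'M[T]_(p, q)) :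
  (forall i j, continuous (fun t => F t i j)) -> continuous F.
Proof.
move=> cF t A [P nP sPA].
have : \forall s \near t, forall i j, P i j (F s i j).
  apply: (filter_forall (F := nbhs t)) => i.
  apply: (filter_forall (F := nbhs t)) => j.
  exact: cF (nP i j).
by apply: filterS => s Ps; apply: sPA.
Qed.

Lemma continuous_omega D (u : R -> R) : continuous u ->
  continuous (fun t => omega D (u t) : complexes R).
Proof.
move=> cu; have ca : continuous (fun t => 2 * pi * u t / D%:R).
  by move=> t; apply: cvgMr_tmp; apply: cvgMl_tmp; exact: cu.
apply: continuous_complex => t.
  by apply: (cvg_comp _ cos (ca t)); exact: continuous_cos.
by apply: (cvg_comp _ sin (ca t)); exact: continuous_sin.
Qed.

Lemma continuous_phase_state D n (f g : config D n -> R) :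
  continuous (fun t : R => phase_state (fun x => f x + g x * t)
    : 'cV[complexes R]_(dimH D n)).
Proof.
apply: continuous_mx => a j.
rewrite (_ : (fun _ => _) = (fun t => (sqrtC D%:R)^-1 ^+ n *
    omega D (f (label a) + g (label a) * t) : complexes R)); last first.
  by apply/funext => t; rewrite mxE.
have cphase : continuous (fun t => f (label a) + g (label a) * t).
  by move=> t; apply: cvgD; [exact: cvg_cst | apply: cvgMl_tmp; exact: cvg_id].
by move=> t; apply: cvgMl_tmp; exact: (continuous_omega cphase).
Qed.

End Continuity.

(** * Interpolation for a general phase exponent *)

Section Interpolation.
Context {R : realType} {D n : nat}.

Lemma LU_equivalent_phase_state (m m' : config D n) (q : config D n -> R) :
  LU_equivalent (phase_state (fun x => (\sum_i m i * x i)%:R + q x))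
                (phase_state (fun x => (\sum_i m' i * x i)%:R + q x)).
Proof.
(* This is Z to the power m'_i - m_i, written as a phase because the difference may be negative. *)
exists (fun i => local_phase (fun k => ((m' i)%:R - (m i)%:R) * k%:R : R)).
split=> [i|]; first exact: local_phase_unitary.
rewrite tens_op_local_phase phase_op_state; apply: eq_phase_state => x /=.
under [X in _ = X + _]eq_bigr do rewrite mulrBl -!natrM.
by rewrite sumrB !natr_sum addrA subrK.
Qed.

(** This is the family at t = 0: the exponent is a sum of one-party terms, so the amplitude
    factors. *)
Lemma is_product_phase_state (m : config D n) :
  is_product (phase_state (fun x : config D n => (\sum_i m i * x i)%:R : R)).
Proof.
exists (fun i => \col_k ((sqrtC D%:R)^-1 * omega D ((m i * k)%:R : R))).
apply/colP => a; rewrite !mxE; under [RHS]eq_bigr do rewrite mxE.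
by rewrite big_split /= prodr_const card_ord -omega_sum natr_sum.
Qed.

(** Only the form of the exponent matters: [m] enters through one-party terms, which makes the
    states locally equivalent, and [t] through a term common to all [m], which cancels in inner
    products. *)
Lemma interpolation_phase_state (q : config D n -> R)
    (G : R -> config D n -> state R D n) (B : config D n -> state R D n) :
  (0 < D)%N ->
  (forall t m,
    G t m = phase_state (fun x => (\sum_i m i * x i)%:R + q x * t)) ->
  G 1 =1 B -> equally_entangled_interpolation G B.
Proof.
move=> D0 GE G1.
have oG t m m' : braket (G t m) (G t m') = (m == m')%:R.
  by rewrite !GE braket_phase_state.
have LU t m m' : LU_equivalent (G t m) (G t m').
  by rewrite !GE; exact: LU_equivalent_phase_state.
split=> //.
- by move=> t _; apply: orthonormal_is_basis.
- move=> m; apply: continuous_subspaceT.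
  rewrite (_ : (fun _ => _) = fun t => phase_state
    (fun x => (\sum_i m i * x i)%:R + q x * t)); last exact/funext.
  exact: continuous_phase_state.
- split=> //; split; first exact: orthonormal_is_basis.
  move=> m; rewrite GE; have := is_product_phase_state m.
  by congr is_product; apply: eq_phase_state => x; rewrite mulr0 addr0.
- move=> t _ E measE m m'; apply/eqP; rewrite eq_le.
  by rewrite !LU_equivalent_le // oG eqxx.
Qed.

End Interpolation.

(** * GHZ states *)

(** The double sum splits into the diagonal and two triangles, which are exchanged by swapping the
    indices. *)
Lemma sqr_sum_pairs (K : comPzRingType) n (F : 'I_n -> K) :
  (\sum_i F i) ^+ 2 =
  \sum_i F i ^+ 2 + (\sum_(i < n) \sum_(j < n | (i < j)%N) F i * F j) *+ 2.
Proof.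
rewrite expr2 mulr_suml; under eq_bigr => i _.
  rewrite mulr_sumr (bigD1 i) //= (bigID (fun j : 'I_n => (i < j)%N)) /=.
  over.
rewrite !big_split /=; congr (_ + _); rewrite mulr2n; congr (_ + _).
  apply: eq_bigr => i _; apply: eq_bigl => j.
  by rewrite -(inj_eq val_inj) /=; case: ltngtP.
rewrite (exchange_big_dep predT) //=; apply: eq_bigr => i _.
apply: eq_big => [j|j _]; last exact: mulrC.
by rewrite -(inj_eq val_inj) /=; case: ltngtP.
Qed.

(** * Gauss sums and the discrete Fourier transform *)

Section Chirp.
Context {R : realType} (D : nat).
Hypothesis D_gt0 : (0 < D)%N.

(* The exponent is taken to be y (y + D) / 2 rather than y ^ 2 / 2 so that the
   chirp is periodic modulo D for odd D as well. *)
Definition half_square (y : R) : R := y * (y + D%:R) / 2.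

(** The summand of the k-th discrete Fourier coefficient of omega^f, where f is [half_square]. *)
Definition chirp (k y : nat) : R[i] :=
  omega D (half_square y%:R - k%:R * y%:R).

(** Both f(y + D) - f(y) = (y + D) D and k (y + D) - k y = k D are integer multiples of [D], on
    which [omega] is 1. *)
Lemma chirpDn k y : chirp k (y + D) = chirp k y.
Proof.
transitivity (chirp k y * omega D ((y + D) * D)%:R * omega D (- (k * D)%:R)).
  rewrite /chirp -!omegaD !natrM natrD /half_square; congr omega; by field.
by rewrite -conj_omega !omega_nat_period // conjC1 !mulr1.
Qed.

Lemma chirp_mod k y : chirp k (y %% D) = chirp k y.
Proof.
rewrite [in RHS](divn_eq y D) addnC; elim: (y %/ D)%N => [|q IH].
  by rewrite addn0.
by rewrite mulSnr addnA chirpDn.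
Qed.

(** The Fourier coefficient of omega^f, normalised to have modulus 1. *)
Definition chirp_coef (k : 'I_D) : R[i] :=
  (sqrtC D%:R)^-1 * \sum_(y < D) chirp k y.

(** The polar form of f is bilinear: f(y + d) - f(y) - f(d) = d y. *)
Lemma chirp_shift k y d :
  Num.conj (chirp k y) * chirp k (y + d) = omega D (d%:R * y%:R) * chirp k d.
Proof.
rewrite /chirp conj_omega -!omegaD natrD /half_square; congr omega; by field.
Qed.

Lemma sum_omega0 (d : 'I_D) :
  \sum_(k < D) omega D (d%:R * k%:R : R) = D%:R * ((d : nat) == 0)%:R.
Proof.
have := sum_omega (R := R) D_gt0 (Ordinal D_gt0) d.
by under eq_bigr do rewrite subr0; rewrite eq_sym.
Qed.

(** A quadratic Gauss sum: the squared modulus is a double sum over y and z; with z = y + d modulo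
    [D], summing over y first leaves only d = 0. *)
Lemma chirp_coef_unit k : Num.conj (chirp_coef k) * chirp_coef k = 1.
Proof.
rewrite /chirp_coef rmorphM /= conj_invsqrt_nat mulrACA sqr_invsqrt_nat.
rewrite rmorph_sum /= mulr_suml.
have shift (y : 'I_D) : Num.conj (chirp k y) * (\sum_(z < D) chirp k z) =
    \sum_(d < D) omega D (d%:R * y%:R) * chirp k d.
  have bij : injective (fun d : 'I_D => Ordinal (ltn_pmod (y + d) D_gt0)).
    move=> d d' /(congr1 val) /= /eqP; rewrite eqn_modDl !modn_small //.
    by move/eqP/val_inj.
  rewrite mulr_sumr (reindex_inj bij) /=; apply: eq_bigr => d _.
  by rewrite chirp_mod chirp_shift.
rewrite (eq_bigr _ (fun y _ => shift y)).
rewrite exchange_big /=; under eq_bigr do rewrite -mulr_suml sum_omega0.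
rewrite (bigD1 (Ordinal D_gt0)) //= big1 => [|d]; last first.
  by rewrite -(inj_eq val_inj) /= => /negPf ->; rewrite mulr0 mul0r.
rewrite addr0 mulr1 /chirp /half_square !mulr0 !mul0r subrr omega0 mulr1.
by rewrite mulVf // pnatr_eq0 -lt0n.
Qed.

(** Fourier inversion for omega^f. The argument [s] is an arbitrary natural number because it will
    be a sum of labels, which can exceed [D]; periodicity brings it back to its residue [r]. *)
Lemma chirp_inversion s :
  (sqrtC D%:R)^-1 * (\sum_(k < D) chirp_coef k * omega D (k%:R * s%:R)) =
  omega D (half_square s%:R).
Proof.
rewrite /chirp_coef; under eq_bigr do rewrite -mulrA.
rewrite -mulr_sumr mulrA sqr_invsqrt_nat.
under eq_bigr do rewrite mulr_suml.
rewrite exchange_big /=.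
pose r : 'I_D := Ordinal (ltn_pmod s D_gt0).
have inner (y : 'I_D) :
    \sum_(k < D) chirp k y * omega D (k%:R * s%:R) =
    omega D (half_square y%:R) * (D%:R * (y == r)%:R).
  rewrite -(sum_omega (R := R) D_gt0) mulr_sumr; apply: eq_bigr => k _.
  rewrite /chirp -!omegaD [in LHS](divn_eq s D) natrD.
  rewrite -[RHS]mulr1 -(@omega_nat_period R D D_gt0 (k * (s %/ D))) -omegaD.
  rewrite !natrM; congr omega; rewrite /=; ring.
under eq_bigr do rewrite inner.
rewrite (bigD1 r) //= big1 => [|y /negPf ->]; last by rewrite !mulr0.
rewrite eqxx mulr1 addr0 mulrCA mulVf ?mulr1 ?pnatr_eq0 -?lt0n //.
(* [chirp 0] is omega^f, so its periodicity replaces the residue by [s]. *)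
by have := chirp_mod 0 s; rewrite /chirp !mul0r !subr0.
Qed.

Definition fourier : 'M[R[i]]_D :=
  \matrix_(j, k) ((sqrtC D%:R)^-1 * omega D (k%:R * j%:R)).

Lemma fourier_unitary : fourier \is unitarymx.
Proof.
apply/unitarymxP/matrixP => j l; rewrite !mxE.
transitivity ((D%:R)^-1 * \sum_(k < D) omega D ((j%:R - l%:R) * k%:R : R)).
  rewrite mulr_sumr; apply: eq_bigr => k _.
  rewrite !mxE rmorphM /= conj_invsqrt_nat mulrACA sqr_invsqrt_nat conj_omega.
  by rewrite -omegaD; congr (_ * omega _ _); ring.
by rewrite sum_omega // mulrA mulVf ?mul1r ?[l == j]eq_sym // pnatr_eq0 -lt0n.
Qed.

Lemma chirp_coef_unitary : diag_mx (\row_k chirp_coef k) \is unitarymx.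
Proof.
apply/unitarymxP/matrixP => j k.
rewrite mul_diag_mx !mxE eq_sym; case: eqP => [->|_] /=.
  by rewrite !mulr1n mulrC chirp_coef_unit.
by rewrite !mulr0n rmorph0 mulr0.
Qed.

End Chirp.

(** * The GHZ state and the complete graph *)

Section GHZ.
Context {R : realType} {D n : nat}.

Lemma ghz_tunedE (t : R) :
  ghz_tuned D n t = tuned_graph_state D (@complete_graph n) t.
Proof.
rewrite /ghz_tuned /tuned_graph_state /circuit; congr (_ *m _).
apply: eq_bigr => i _; apply: eq_bigl => j.
by rewrite /complete_graph neq_ltn; case: ltnP; rewrite ?andbF.
Qed.

(** The part of f linear in y is additive and cancels, which leaves half of (sum x_i)^2 - sum x_i^2,
    the sum over pairs. *)
Lemma pair_sum_complete (x : config D n) :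
  (pair_sum (@complete_graph n) x)%:R =
  half_square D (\sum_i x i)%:R - \sum_i half_square D (x i)%:R :> R.
Proof.
have := sqr_sum_pairs (fun i => (x i)%:R : R).
rewrite /half_square -mulr_suml.
under [X in _ - X / _]eq_bigr do rewrite mulrDr -expr2.
rewrite big_split /= -mulr_suml natr_sum.
have -> : (pair_sum (@complete_graph n) x)%:R =
    \sum_(i < n) \sum_(j < n | (i < j)%N) (x i)%:R * (x j)%:R :> R.
  rewrite /pair_sum natr_sum; apply: eq_bigr => i _; rewrite natr_sum.
  apply: eq_big => [j|j _]; last exact: natrM.
  by rewrite /complete_graph neq_ltn; case: ltnP; rewrite ?andbF.
lra.
Qed.

Lemma ghz_LU_complete_graph : (0 < D)%N -> (0 < n)%N ->
  LU_equivalent (ghz R D n) (ghz_tuned D n (1 : R)).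
Proof.
move=> D0 n0; pose i0 : 'I_n := Ordinal n0.
(* The Fourier matrices turn the tensor power of |k> into the phases omega^(k (x_1 + ... + x_n)),
   the outer phases supply the terms -f(x_i), and the coefficient of [k] must enter once, hence on
   party [i0] alone. *)
exists (fun i => local_phase (fun j : 'I_D => - half_square D j%:R) *m
  (fourier D *m (if i == i0 then diag_mx (\row_k chirp_coef k) else 1%:M))).
split=> [i|].
  apply: mul_unitarymx; first exact: local_phase_unitary.
  apply: mul_unitarymx; first exact: fourier_unitary.
  case: (i == i0); first exact: chirp_coef_unitary.
  by apply/unitarymxP; rewrite trmx1 map_mx1 mulmx1.
rewrite ghz_tunedE tuned_graph_phase_state.
have image k i j : (local_phase (fun j : 'I_D => - half_square D j%:R : R) *m
      (fourier D *m (if i == i0 then diag_mx (\row_k chirp_coef k) else 1%:M)) *m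
      ket R k) j 0 =
    (sqrtC D%:R)^-1 * omega D (k%:R * j%:R - half_square D j%:R : R) *
    (if i == i0 then chirp_coef k else 1).
  rewrite -colE mxE mul_diag_mx mxE mxE addrC omegaD; case: (i == i0).
    by rewrite mul_mx_diag !mxE; ring.
  by rewrite mulmx1 !mxE; ring.
apply/colP => a; rewrite /ghz -scalemxAr mulmx_sumr !mxE summxE.
under eq_bigr => k _.
  rewrite tens_op_vec mxE; under eq_bigr do rewrite image.
  rewrite big_split big_split /= prodr_const card_ord -omega_sum.
  rewrite -big_mkcond big_pred1_eq sumrB.
  over.
set x := label a.
(* Inversion at s = x_1 + ... + x_n expands omega^f of that sum over [k], matching the sum in the
   GHZ state. *)
rewrite mulr1 pair_sum_complete omegaD -(chirp_inversion D0).
rewrite !(mulr_sumr, mulr_suml); apply: eq_bigr => k _.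
rewrite omegaD natr_sum mulr_sumr; ring.
Qed.

End GHZ.

(** * Application to graph bases *)

Section InterpolationOfGraphBases.
Context {R : realType} {D n : nat}.

Lemma interpolation_tuned_graph_basis (e : rel 'I_n) : (0 < D)%N ->
  equally_entangled_interpolation
    (@tuned_graph_basis R D n e) (@graph_basis R D n e).
Proof.
move=> D0.
apply: (@interpolation_phase_state _ _ _ (fun x => (pair_sum e x)%:R)) => //.
move=> t m; rewrite /tuned_graph_basis tuned_graph_phase_state Zpow_phase_op.
by rewrite phase_op_state.
Qed.

(** This form serves the circuits written out gate by gate in the GHZ statements. *)
Lemma interpolation_tuned_state (psi : R -> state R D n) (e : rel 'I_n) :
  (0 < D)%N -> (forall t, psi t = tuned_graph_state D e t) ->
  equally_entangled_interpolation
    (fun t m => Zpow R m *m psi t) (@graph_basis R D n e).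
Proof.
move=> D0 psiE; rewrite (_ : (fun t m => _) = @tuned_graph_basis R D n e).
  exact: interpolation_tuned_graph_basis.
by apply/funext => t; apply/funext => m; rewrite psiE.
Qed.

End InterpolationOfGraphBases.

(** The gates are diagonal, so their exponents add and the order 12, 23, 13 is immaterial. *)
Lemma three_qubit_circuit (R : realType) (t : R) :
  CPt 2 t (inord 0 : 'I_3) (inord 1) *m CPt 2 t (inord 1) (inord 2) *m
    CPt 2 t (inord 0) (inord 2) *m plus_state R 2 3 =
  tuned_graph_state 2 (@complete_graph 3) t.
Proof.
rewrite !CPt_phase_op -?val_eqE /= ?inordK // tuned_graph_phase_state.
rewrite plus_phase_state !phase_op_mul phase_op_state.
apply: eq_phase_state => x; rewrite addr0 -!mulrDl -!natrD; congr (_%:R * _).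
rewrite /pair_sum /complete_graph !big_ord_recl !big_ord0.
rewrite !(big_mkcond (fun j : 'I_3 => (_ < j)%N && _)) /=.
rewrite !big_ord_recl !big_ord0 /=.
have -> : inord 0 = ord0 :> 'I_3 by apply: val_inj; rewrite /= inordK.
have -> : inord 1 = lift ord0 ord0 :> 'I_3 by apply: val_inj; rewrite /= inordK.
have -> : inord 2 = lift ord0 (lift ord0 ord0) :> 'I_3.
  by apply: val_inj; rewrite /= inordK.
by rewrite !(addn0, add0n) addnAC.
Qed.

Lemma ghz_three_qubits (R : realType) :
  (sqrtC 2)^-1 *: (tens_vec (fun _ : 'I_3 => ket R (ord0 : 'I_2))
                   + tens_vec (fun _ : 'I_3 => ket R (ord_max : 'I_2))) =
  ghz R 2 3.
Proof.
rewrite /ghz !big_ord_recl big_ord0 addr0.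
by rewrite (_ : lift ord0 ord0 = ord_max :> 'I_2) //; apply: val_inj.
Qed.

Theorem mainTheorem3 (R : realType) :
  [/\ (* any graph state of any dimension *)
      forall (D n : nat) (e : rel 'I_n),
        (0 < D)%N -> symmetric e -> irreflexive e ->
        equally_entangled_interpolation
          (@tuned_graph_basis R D n e) (@graph_basis R D n e),
      (* the bipartite construction is the case of a single edge *)
      forall (D : nat) (t : R) (m : config D 2), (0 < D)%N ->
        tuned_graph_basis (@complete_graph 2) t m = bipartite_family t m,
      (* three-qubit GHZ state *)
      let p1 : 'I_3 := inord 0 in
      let p2 : 'I_3 := inord 1 in
      let p3 : 'I_3 := inord 2 in
      let psi (t : R) : state R 2 3 :=
        CPt 2 t p1 p2 *m CPt 2 t p2 p3 *m CPt 2 t p1 p3 *m plus_state R 2 3 in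
      let GHZ3 : state R 2 3 :=
        (sqrtC 2)^-1 *: (tens_vec (fun _ : 'I_3 => ket R (ord0 : 'I_2))
                         + tens_vec (fun _ : 'I_3 => ket R (ord_max : 'I_2))) in
      [/\ psi 1 = graph_state R 2 (@complete_graph 3),
          LU_equivalent GHZ3 (psi 1)
        & equally_entangled_interpolation
            (fun t m => Zpow R m *m psi t)
            (@graph_basis R 2 3 (@complete_graph 3))]
    & (* GHZ states of n parties of dimension D, from the complete graph *)
      forall (D n : nat), (0 < D)%N -> (0 < n)%N ->
      [/\ ghz_tuned D n (1 : R) = graph_state R D (@complete_graph n),
          LU_equivalent (ghz R D n) (ghz_tuned D n (1 : R))
        & equally_entangled_interpolation
            (fun t m => Zpow R m *m ghz_tuned D n t)
            (@graph_basis R D n (@complete_graph n))]].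
Proof.
split.
- by move=> D n e D0 _ _; exact: interpolation_tuned_graph_basis.
- move=> D t m D0.
  rewrite /tuned_graph_basis /bipartite_family /tuned_graph_state.
  congr (_ *m (_ *m _)); rewrite circuit_phase_op CPt_phase_op //.
  (* For two parties the only pair i < j is 0 < 1, so the exponents agree. *)
  apply: eq_phase_op => x; rewrite /pair_sum /complete_graph.
  rewrite !big_ord_recl !big_ord0 /=.
  rewrite !(big_mkcond (fun j : 'I_2 => (_ < j)%N && _)).
  rewrite !big_ord_recl !big_ord0 /=.
  rewrite (_ : lift ord0 ord0 = ord_max :> 'I_2) ?addn0 //.
  exact: val_inj.
- split.
  + by rewrite three_qubit_circuit.
  + rewrite three_qubit_circuit ghz_three_qubits -ghz_tunedE.
    exact: ghz_LU_complete_graph.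
  + by apply: interpolation_tuned_state => // t; exact: three_qubit_circuit.
- move=> D n D0 n0; split.
  + by rewrite ghz_tunedE.
  + exact: ghz_LU_complete_graph.
  + by apply: interpolation_tuned_state => // t; exact: ghz_tunedE.
Qed.
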